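(* Let $(Q,+,\cdot,\le)$ be an arbitrary ordered field and $n\ge 2$. Neither the relation $\tau$ nor the relation $\sigma$ is definable in $(Q^n,\lambda)$ by an existential formula or by a universal formula.
   Context: For $p=(p_0,\dots,p_{n-1}),\,q=(q_0,\dots,q_{n-1})\in Q^n$: $p\,\tau\,q$ iff $(p_0-q_0)^2>\sum_{i=1}^{n-1}(p_i-q_i)^2$; $p\,\lambda\,q$ iff $(p_0-q_0)^2=\sum_{i=1}^{n-1}(p_i-q_i)^2$ and $p_0\neq q_0$; $p\,\sigma\,q$ iff $(p_0-q_0)^2<\sum_{i=1}^{n-1}(p_i-q_i)^2$. An existential (universal) formula is one of the form $\exists z_1\cdots\exists z_k\,\psi$ (resp. $\forall z_1\cdots\forall z_k\,\psi$) with $\psi$ quantifier-free, in the language with equality and one binary relation symbol interpreted as $\lambda$; definitions are without parameters. *)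

(* Defs.v *)
From HB Require Import structures.
From mathcomp Require Import all_boot all_order all_algebra.

Set Implicit Arguments.
Unset Strict Implicit.
Unset Printing Implicit Defensive.

Import Order.TTheory GRing.Theory Num.Theory.
Local Open Scope ring_scope.

(* First-order formulas over equality and one binary relation symbol, with
   variables named by natural numbers; a quantifier may rebind a name. *)
Inductive formula : Type :=
  | FEq of nat & nat
  | FRel of nat & nat
  | FNot of formula
  | FAnd of formula & formula
  | FOr of formula & formula
  | FImp of formula & formula
  | FEx of nat & formula
  | FAll of nat & formula.

Definition upd (T : Type) (e : nat -> T) (i : nat) (a : T) : nat -> T :=
  fun j => if j == i then a else e j.

Fixpoint sat (T : Type) (r : T -> T -> Prop) (e : nat -> T) (f : formula) : Prop :=
  match f with
  | FEq i j => e i = e j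
  | FRel i j => r (e i) (e j)
  | FNot g => ~ sat r e g
  | FAnd g h => sat r e g /\ sat r e h
  | FOr g h => sat r e g \/ sat r e h
  | FImp g h => sat r e g -> sat r e h
  | FEx i g => exists a : T, sat r (upd e i a) g
  | FAll i g => forall a : T, sat r (upd e i a) g
  end.

Fixpoint free_vars (f : formula) : seq nat :=
  match f with
  | FEq i j | FRel i j => [:: i; j]
  | FNot g => free_vars g
  | FAnd g h | FOr g h | FImp g h => free_vars g ++ free_vars h
  | FEx i g | FAll i g => [seq j <- free_vars g | j != i]
  end.

Fixpoint quantifier_free (f : formula) : bool :=
  match f with
  | FEq _ _ | FRel _ _ => true
  | FNot g => quantifier_free g
  | FAnd g h | FOr g h | FImp g h => quantifier_free g && quantifier_free h
  | FEx _ _ | FAll _ _ => false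
  end.

Definition existential (f : formula) : Prop :=
  exists (zs : seq nat) (psi : formula),
    quantifier_free psi /\ f = foldr FEx psi zs.

Definition universal (f : formula) : Prop :=
  exists (zs : seq nat) (psi : formula),
    quantifier_free psi /\ f = foldr FAll psi zs.

(* Variables 0 and 1 stand for the two arguments of the defined relation; the
   condition on free variables excludes parameters. *)
Definition defines (T : Type) (r : T -> T -> Prop) (f : formula)
    (s : T -> T -> Prop) : Prop :=
  {subset free_vars f <= [:: 0%N; 1%N]} /\
  forall e : nat -> T, sat r e f <-> s (e 0%N) (e 1%N).

Definition existentially_definable (T : Type) (r s : T -> T -> Prop) : Prop :=
  exists f : formula, existential f /\ defines r f s.

Definition universally_definable (T : Type) (r s : T -> T -> Prop) : Prop :=
  exists f : formula, universal f /\ defines r f s.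

Section Minkowski.
Variables (Q : realFieldType) (n : nat).
Implicit Types p q : 'rV[Q]_n.+1.

Definition time_sq p q : Q := (p 0 ord0 - q 0 ord0) ^+ 2.

Definition space_sq p q : Q :=
  \sum_(i < n.+1 | i != ord0) (p 0 i - q 0 i) ^+ 2.

Definition tau p q : Prop := space_sq p q < time_sq p q.

Definition lambda p q : Prop :=
  time_sq p q = space_sq p q /\ p 0 ord0 <> q 0 ord0.

Definition sigma p q : Prop := time_sq p q < space_sq p q.

End Minkowski.

(* Main.v *)
Require Import Defs.
From mathcomp Require Import all_boot all_order all_algebra.
From mathcomp Require Import ring lra.

(** An existential formula holding at [(p, q)] only sees the finitely many points
    of a witnessing assignment, so it survives any map that preserves [lambda] and
    its negation on a finite set of points.  Let [m] be the Minkowski form.  The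
    inversion [x |-> (x - z) / m (x - z)] at a centre [z] satisfies
    [m (f x - f y) = m (x - y) / (m (x - z) * m (y - z))].  It therefore preserves
    [lambda] in both directions on every finite set of points off the light cone
    of [z], but it exchanges [tau] and [sigma] on the pair [(p, q)] as soon as
    [m (p - z)] and [m (q - z)] have opposite signs.  Such centres can be found on
    a segment that meets each of the finitely many cones to be avoided in at most
    two points. *)

Set Implicit Arguments.
Unset Strict Implicit.
Unset Printing Implicit Defensive.

Import Order.TTheory GRing.Theory Num.Theory.
Local Open Scope ring_scope.

(** * Quantifier prefixes and maps that embed finite sets *)

Section LocalEmbeddings.
Variables (T : eqType) (r : T -> T -> Prop).

(** [f] restricts to an isomorphism of [A] onto its image; for equality only injectivity has to be
    asked. *)
Definition local_embedding (A : seq T) (f : T -> T) : Prop :=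
  {in A &, forall x y, (f x = f y -> x = y) /\ (r (f x) (f y) <-> r x y)}.

Lemma sat_quantifier_free (e e' : nat -> T) (psi : formula) :
  quantifier_free psi ->
  {in free_vars psi &, forall i j,
     (e i = e j <-> e' i = e' j) /\ (r (e i) (e j) <-> r (e' i) (e' j))} ->
  sat r e psi <-> sat r e' psi.
Proof.
elim: psi => //=.
- move=> i j _ h; have [] := h i j; rewrite ?inE ?eqxx ?orbT //.
- move=> i j _ h; have [] := h i j; rewrite ?inE ?eqxx ?orbT //.
- by move=> g IH qg h; have := IH qg h; tauto.
- move=> g IHg k IHk /andP[qg qk] h.
  have := IHg qg (sub_in2 (mem_subseq (prefix_subseq _ _)) h).
  have := IHk qk (sub_in2 (mem_subseq (suffix_subseq _ _)) h); tauto.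
- move=> g IHg k IHk /andP[qg qk] h.
  have := IHg qg (sub_in2 (mem_subseq (prefix_subseq _ _)) h).
  have := IHk qk (sub_in2 (mem_subseq (suffix_subseq _ _)) h); tauto.
- move=> g IHg k IHk /andP[qg qk] h.
  have := IHg qg (sub_in2 (mem_subseq (prefix_subseq _ _)) h).
  have := IHk qk (sub_in2 (mem_subseq (suffix_subseq _ _)) h); tauto.
Qed.

Lemma sat_quantifier_free_ext (e e' : nat -> T) (psi : formula) :
  quantifier_free psi -> e =1 e' -> sat r e psi <-> sat r e' psi.
Proof. by move=> qf ee; apply: sat_quantifier_free => // i j _ _; rewrite !ee. Qed.

Lemma sat_local_embedding (e : nat -> T) (psi : formula) (f : T -> T) :
  quantifier_free psi -> local_embedding (map e (free_vars psi)) f ->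
  sat r e psi <-> sat r (f \o e) psi.
Proof.
move=> qf hf; apply: sat_quantifier_free => // i j hi hj /=.
have [] := hf (e i) (e j); rewrite ?map_f // => inj hr.
by split; [split => [->|] | tauto].
Qed.

Lemma sat_foldr_FEx (psi : formula) (zs : seq nat) (e : nat -> T) :
  quantifier_free psi ->
  sat r e (foldr FEx psi zs) <->
  exists e', (forall j, j \notin zs -> e' j = e j) /\ sat r e' psi.
Proof.
move=> qf; elim: zs e => [|z zs IH] e /=.
  split=> [h|[e' [ee' h]]]; first by exists e.
  by apply/(@sat_quantifier_free_ext e' e) => // j; apply: ee'.
split=> [[a /IH[e' [ee' h]]]|[e' [ee' h]]].
  exists e'; split=> // j; rewrite inE negb_or => /andP[jz jzs].
  by rewrite ee' // /upd (negbTE jz).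
(* Names may repeat in the prefix. The final value [e' z] is a safe witness for the outer [z],
   whether or not [z] is bound again in [zs]. *)
exists (e' z); apply/IH; exists e'; split=> // j jzs; rewrite /upd.
by case: eqVneq => [->//|jz]; rewrite ee' // inE negb_or jz.
Qed.

Lemma sat_foldr_FAll (psi : formula) (zs : seq nat) (e : nat -> T) :
  quantifier_free psi ->
  sat r e (foldr FAll psi zs) <->
  forall e', (forall j, j \notin zs -> e' j = e j) -> sat r e' psi.
Proof.
move=> qf; elim: zs e => [|z zs IH] e /=.
  split=> [h e' ee'|]; last by apply.
  by apply/(@sat_quantifier_free_ext e' e) => // j; apply: ee'.
split=> [h e' ee'|h a].
  have /IH := h (e' z); apply=> j jzs; rewrite /upd.
  by case: eqVneq => [->//|jz]; rewrite ee' // inE negb_or jz.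
apply/IH => e' ee'; apply: h => j; rewrite inE negb_or => /andP[jz jzs].
by rewrite ee' // /upd (negbTE jz).
Qed.

(* The bound variables [zs] may rebind the names 0 and 1, so the pair [(p, q)]
   is transported through the original assignment, not through the witness. *)
Lemma not_existentially_definable (s : T -> T -> Prop) (p q : T) :
  s p q ->
  (forall A, exists f, local_embedding A f /\ ~ s (f p) (f q)) ->
  ~ existentially_definable r s.
Proof.
move=> spq loc [_ [[zs [psi [qf ->]]] [_ def]]].
pose e j := if j == 0%N then p else q.
have /(sat_foldr_FEx _ _ qf)[e' [ee' h]] := (def e).2 spq.
have [f [hf]] := loc (map e' (free_vars psi)); apply.
apply/(def (f \o e)); apply/sat_foldr_FEx => //; exists (f \o e'); split.
  by move=> j jzs /=; rewrite ee'.
by apply/(sat_local_embedding qf hf).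
Qed.

(** Dual argument: [f] is chosen after the assignment [e'] to be tested, and the truth of [psi] is
    pulled back from [f \o e'] to [e']. *)
Lemma not_universally_definable (s : T -> T -> Prop) (p q : T) :
  ~ s p q ->
  (forall A, exists f, local_embedding A f /\ s (f p) (f q)) ->
  ~ universally_definable r s.
Proof.
move=> spq loc [_ [[zs [psi [qf ->]]] [_ def]]].
pose e j := if j == 0%N then p else q.
apply: spq; apply/(def e)/sat_foldr_FAll => // e' ee'.
have [f [hf sf]] := loc (map e' (free_vars psi)).
apply/(sat_local_embedding qf hf).
have /(sat_foldr_FAll _ _ qf) := (def (f \o e)).2 sf.
by apply=> j jzs /=; rewrite ee'.
Qed.

End LocalEmbeddings.

(** The points [1 / (k + 2)] with [k < size P] are distinct and lie strictly between 0 and 1, and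
    they are too many to be all roots of [P]. *)
Lemma exists_nonroot01 (F : realFieldType) (P : {poly F}) :
  P != 0 -> exists2 x : F, 0 < x < 1 & ~~ root P x.
Proof.
move=> P0; pose g (k : nat) : F := k.+2%:R^-1.
have g_inj : injective g.
  by move=> a b /invr_inj /eqP; rewrite eqr_nat => /eqP[].
pose xs := map g (iota 0 (size P)).
have [/allP allr|/allPn[x /mapP[k _ ->] nr]] := boolP (all (root P) xs); last first.
  by exists (g k); rewrite // /g invr_gt0 ltr0n invf_lt1 ?ltr0n // ltr1n.
have := max_poly_roots P0 (introT allP allr).
by rewrite map_inj_uniq // iota_uniq size_map size_iota ltnn => /(_ isT).
Qed.

(** * The Minkowski form and its inversions *)

Section Minkowski.
Variables (Q : realFieldType) (n : nat).
Implicit Types (x y z p q : 'rV[Q]_n.+1) (i j k : 'I_n.+1).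

Definition mink_sign i : Q := if i == ord0 then 1 else -1.

Definition mink x : Q := \sum_i mink_sign i * x 0 i ^+ 2.

(** Polarization: the last bracket is minus twice the associated bilinear form at [x] and [y]. *)
Lemma minkBZ (a b : Q) x y :
  mink (a *: x - b *: y) =
  a ^+ 2 * mink x + b ^+ 2 * mink y + a * b * (mink (x - y) - mink x - mink y).
Proof.
rewrite /mink -!sumrB !mulr_sumr -!big_split /=.
by apply: eq_bigr => i _; rewrite !mxE; ring.
Qed.

Lemma mink0 : mink 0 = 0.
Proof. by rewrite /mink big1 // => i _; rewrite mxE expr0n mulr0. Qed.

Lemma minkZ (a : Q) x : mink (a *: x) = a ^+ 2 * mink x.
Proof. by rewrite /mink mulr_sumr; apply: eq_bigr => i _; rewrite mxE; ring. Qed.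

Lemma minkN x : mink (- x) = mink x.
Proof. by rewrite -scaleN1r minkZ sqrrN expr1n mul1r. Qed.

Lemma mink_delta k : mink (delta_mx 0 k) = mink_sign k.
Proof.
rewrite /mink (bigD1 k) //= big1 => [|i ik].
  by rewrite mxE !eqxx expr1n mulr1 addr0.
by rewrite mxE (negbTE ik) andbF expr0n mulr0.
Qed.

Lemma minkB_delta j k : j != k ->
  mink (delta_mx 0 j - delta_mx 0 k) = mink_sign j + mink_sign k.
Proof.
move=> jk; rewrite /mink (bigD1 j) //= (bigD1 k) 1?eq_sym //= big1 => [|i].
  by rewrite !mxE !eqxx (eq_sym k) (negbTE jk) /=; ring.
by case/andP=> ij ik; rewrite !mxE (negbTE ij) (negbTE ik) andbF; ring.
Qed.

Lemma time_sq_sub_space_sq p q : time_sq p q - space_sq p q = mink (p - q).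
Proof.
rewrite /mink (bigD1 ord0) //= /mink_sign eqxx mul1r !mxE; congr (_ + _).
rewrite -sumrN; apply: eq_bigr => i i0.
by rewrite (negbTE i0) !mxE mulN1r.
Qed.

Lemma tauE p q : tau p q <-> 0 < mink (p - q).
Proof. by rewrite -time_sq_sub_space_sq subr_gt0. Qed.

Lemma sigmaE p q : sigma p q <-> mink (p - q) < 0.
Proof. by rewrite -time_sq_sub_space_sq subr_lt0. Qed.

Lemma lambdaE p q : lambda p q <-> mink (p - q) = 0 /\ p <> q.
Proof.
rewrite -time_sq_sub_space_sq; split=> [[-> ne]|[/eqP]].
  by rewrite subrr; split=> // pq; rewrite pq in ne.
rewrite subr_eq0 => /eqP ts ne; split=> // pq0; apply: ne.
(* If the time coordinates agree, the spatial sum of squares vanishes too, which forces [p = q]. *)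
have /esym/eqP : time_sq p q = 0 by rewrite /time_sq pq0 subrr expr0n.
rewrite ts eq_sym psumr_eq0 => [/allP h|i _]; last exact: sqr_ge0.
apply/rowP => i; case: (eqVneq i ord0) => [->//|i0].
have := h i (mem_index_enum _); rewrite i0 /= sqrf_eq0 subr_eq0.
by move/eqP.
Qed.

Definition inversion z x := (mink (x - z))^-1 *: (x - z).

(** Also valid on the cone of [z], where the convention [0^-1 = 0] makes both sides zero. *)
Lemma mink_inversion z x : mink (inversion z x) = (mink (x - z))^-1.
Proof.
rewrite minkZ; have [->|h] := eqVneq (mink (x - z)) 0; last by field.
by rewrite invr0 expr0n mul0r.
Qed.

(** In [minkBZ] with [a] and [b] the inverses of the two norms, the square terms reduce to [a + b]
    and cancel against the bracket. *)
Lemma mink_inversionB z x y : mink (x - z) != 0 -> mink (y - z) != 0 ->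
  mink (inversion z x - inversion z y) =
  mink (x - y) / (mink (x - z) * mink (y - z)).
Proof.
move=> hx hy; rewrite minkBZ (_ : x - z - (y - z) = x - y).
  by field; rewrite hx hy.
by rewrite opprB addrA subrK.
Qed.

(** Equal images have equal norms, hence equal nonzero scaling factors, which can be cancelled. *)
Lemma inversion_inj z :
  {in [pred x | mink (x - z) != 0] &, injective (inversion z)}.
Proof.
move=> x y; rewrite !inE => hx hy exy.
have /invr_inj mxy : (mink (x - z))^-1 = (mink (y - z))^-1.
  by rewrite -!mink_inversion exy.
move: exy; rewrite /inversion mxy => /(scalerI (invr_neq0 hy)) /eqP.
by rewrite (inj_eq (addIr _)) => /eqP.
Qed.

Lemma local_embedding_inversion z (A : seq 'rV[Q]_n.+1) :
  {in A, forall x, mink (x - z) != 0} ->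
  local_embedding (@lambda Q n) A (inversion z).
Proof.
move=> hA x y xA yA; have [hx hy] := (hA x xA, hA y yA).
have inj : inversion z x = inversion z y -> x = y by apply: inversion_inj.
split=> //; rewrite !lambdaE mink_inversionB //.
split=> [[/eqP]|[-> ne]].
  rewrite mulf_eq0 invr_eq0 mulf_eq0 (negbTE hx) (negbTE hy) !orbF.
  by move=> /eqP -> ne; split=> // xy; apply: ne; rewrite xy.
by rewrite mul0r; split=> // /inj.
Qed.

(** For fixed [x] the norm is a polynomial [c x] in [s] with leading coefficient 1 or -1; a nonroot
    of the product over [A] avoids all the cones. *)
Lemma exists_inversion_centre j (A : seq 'rV[Q]_n.+1) :
  exists2 s : Q, 0 < s < 1 &
    {in A, forall x, mink (x - s *: delta_mx 0 j) != 0}.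
Proof.
pose d x := mink (x - delta_mx 0 j) - mink x - mink_sign j.
pose c x : {poly Q} := (mink_sign j)%:P * 'X^2 + (d x)%:P * 'X + (mink x)%:P.
have cE x s : (c x).[s] = mink (x - s *: delta_mx 0 j).
  rewrite -[X in mink (X - _)]scale1r minkBZ mink_delta /c /d.
  by rewrite !(hornerD, hornerM, hornerC, hornerXn, hornerX); ring.
have c0 x : c x != 0.
  apply/eqP => /(congr1 (fun P : {poly Q} => P`_2)).
  rewrite !coefD !coefCM coefXn coefX !coefC /= mulr1 mulr0 !addr0 /mink_sign.
  by case: ifP => _ /eqP; rewrite ?oppr_eq0 oner_eq0.
have P0 : \prod_(x <- A) c x != 0 by rewrite prodf_seq_neq0; apply/allP => x _ /=.
have [s s01 nr] := exists_nonroot01 P0; exists s => // x xA.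
apply: contra nr; rewrite -cE => cx0.
by rewrite (big_rem x) //= rootM /root cx0.
Qed.

(** Seen from a centre [s *: delta_mx 0 j] with [0 < s < 1], the points 0 and [delta_mx 0 k] have
    norms of opposite signs, so inversion flips the sign of the norm of their difference. The factor
    [mink_sign j] treats both directions at once. *)
Lemma exists_switching_embedding j k (A : seq 'rV[Q]_n.+1) :
  mink_sign j = - mink_sign k ->
  exists f, local_embedding (@lambda Q n) A f /\
    0 < mink_sign j * mink (f (delta_mx 0 k) - f 0).
Proof.
move=> jk; have [s /andP[s0 s1] hs] := exists_inversion_centre j A.
have sg : mink_sign k ^+ 2 = 1 by rewrite /mink_sign; case: ifP => _; rewrite ?sqrrN expr1n.
have sgn0 : mink_sign k != 0.
  by apply/eqP => e; move: sg; rewrite e expr0n => /esym/eqP; rewrite oner_eq0.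
have njk : j != k.
  apply/eqP => e; move: jk; rewrite e => h.
  by move/eqP: sgn0; apply; lra.
exists (inversion (s *: delta_mx 0 j)); split.
  exact: local_embedding_inversion.
have s2 : 0 < 1 - s ^+ 2 by nra.
have m0 : mink (0 - s *: delta_mx 0 j) = - (mink_sign k * s ^+ 2).
  by rewrite sub0r minkN minkZ mink_delta jk; ring.
have mk : mink (delta_mx 0 k - s *: delta_mx 0 j) = mink_sign k * (1 - s ^+ 2).
  rewrite -{1}[delta_mx 0 k]scale1r minkBZ minkB_delta 1?eq_sym // !mink_delta jk.
  ring.
have n1 : s != 0 by rewrite gt_eqF.
have n2 : 1 - s ^+ 2 != 0 by rewrite gt_eqF.
rewrite mink_inversionB ?mk ?m0 ?oppr_eq0 ?mulf_neq0 ?expf_neq0 //.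
rewrite subr0 mink_delta jk.
rewrite (_ : _ * _ = ((1 - s ^+ 2) * s ^+ 2)^-1); last by field; rewrite n1 n2.
by rewrite invr_gt0 mulr_gt0 // exprn_gt0.
Qed.

End Minkowski.

Theorem theorem4p12 (Q : realFieldType) (n : nat) (hn : (2 <= n.+1)%N) :
  ~ existentially_definable (@lambda Q n) (@tau Q n) /\
  ~ universally_definable (@lambda Q n) (@tau Q n) /\
  ~ existentially_definable (@lambda Q n) (@sigma Q n) /\
  ~ universally_definable (@lambda Q n) (@sigma Q n).
Proof.
(* Dimension at least two makes the last axis spatial. *)
have max0 : (@ord_max n == ord0) = false by case: n hn.
pose t : 'rV[Q]_n.+1 := delta_mx 0 ord0.
pose x : 'rV[Q]_n.+1 := delta_mx 0 ord_max.
have mt : mink (t - 0) = 1 by rewrite subr0 mink_delta /mink_sign eqxx.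
have mx : mink (x - 0) = -1 by rewrite subr0 mink_delta /mink_sign max0.
have tau_t : tau t 0 by apply/tauE; rewrite mt.
have sigma_x : sigma x 0 by apply/sigmaE; rewrite mx oppr_lt0.
have ntau (p q : 'rV[Q]_n.+1) : sigma p q -> ~ tau p q by rewrite /sigma /tau => /ltW; case: ltP.
have nsigma (p q : 'rV[Q]_n.+1) : tau p q -> ~ sigma p q by move=> h /ntau.
have to_sigma A : exists f, local_embedding (@lambda Q n) A f /\ sigma (f t) (f 0).
  have [|f [hf h]] := @exists_switching_embedding Q n ord_max ord0 A.
    by rewrite /mink_sign max0 eqxx.
  by exists f; split=> //; apply/sigmaE; move: h; rewrite /mink_sign max0; lra.
have to_tau A : exists f, local_embedding (@lambda Q n) A f /\ tau (f x) (f 0).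
  have [|f [hf h]] := @exists_switching_embedding Q n ord0 ord_max A.
    by rewrite /mink_sign max0 eqxx opprK.
  by exists f; split=> //; apply/tauE; move: h; rewrite /mink_sign eqxx; lra.
(* [to_sigma] refutes an existential definition of [tau] and a universal one of [sigma]; [to_tau]
   handles the other two cases. *)
split; [|split; [|split]].
- apply: (not_existentially_definable tau_t) => A.
  by have [f [hf /ntau]] := to_sigma A; exists f.
- exact: (not_universally_definable (ntau _ _ sigma_x) to_tau).
- apply: (not_existentially_definable sigma_x) => A.
  by have [f [hf /nsigma]] := to_tau A; exists f.
- exact: (not_universally_definable (nsigma _ _ tau_t) to_sigma).
Qed.
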